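(* Let $\Gamma,\Delta$ be finite multisets of formulas and let $A$ be either a single formula or empty. If the focused sequent $\Gamma\vdash A;\Delta$ has a proof in the focused classical sequent calculus, then the sequent $\Gamma^p,\lrcorner\Delta^n\vdash A^n$ has a proof in the cut-free intuitionistic sequent calculus, where $\Gamma^p=\{B^p:B\in\Gamma\}$, $\lrcorner\Delta^n=\{\lrcorner(B^n):B\in\Delta\}$, and $A^n$ denotes the empty right-hand side when $A$ is empty.
   Context: Formulas are first-order formulas built from atomic formulas with $\wedge,\vee,\Rightarrow,\neg,\forall,\exists$. Antinegation: for a formula $A$, $\lrcorner A$ is $B$ if $A$ is syntactically $\neg B$, and $\neg A$ otherwise (an operation on formulas, not a connective). Polarized Gödel–Gentzen translations ${}^p$ and ${}^n$, defined simultaneously by induction: for atomic $A$, $A^p=A$ and $A^n=\neg\neg A$; $(A\wedge B)^p=A^p\wedge B^p$, $(A\wedge B)^n=A^n\wedge B^n$; $(A\vee B)^p=A^p\vee B^p$, $(A\vee B)^n=\neg(\neg A^n\wedge\neg B^n)$; $(A\Rightarrow B)^p=A^n\Rightarrow B^p$, $(A\Rightarrow B)^n=A^p\Rightarrow B^n$; $(\neg A)^p=\neg A^n$, $(\neg A)^n=\neg A^p$; $(\forall xA)^p=\forall xA^p$, $(\forall xA)^n=\forall xA^n$; $(\exists xA)^p=\exists xA^p$, $(\exists xA)^n=\neg\forall x\neg A^n$. Cut-free intuitionistic sequent calculus: sequents $\Gamma\vdash\Delta$ with $\Delta$ of at most one formula; axiom $\Gamma,A\vdash A$; $\wedge_L$: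 from $\Gamma,A,B\vdash\Delta$ infer $\Gamma,A\wedge B\vdash\Delta$; $\wedge_R$: from $\Gamma\vdash A$, $\Gamma\vdash B$ infer $\Gamma\vdash A\wedge B$; $\vee_L$: from $\Gamma,A\vdash\Delta$, $\Gamma,B\vdash\Delta$ infer $\Gamma,A\vee B\vdash\Delta$; $\vee_{R1},\vee_{R2}$: from $\Gamma\vdash A$ (resp. $\Gamma\vdash B$) infer $\Gamma\vdash A\vee B$; $\Rightarrow_L$: from $\Gamma\vdash A$ and $\Gamma,B\vdash\Delta$ infer $\Gamma,A\Rightarrow B\vdash\Delta$; $\Rightarrow_R$: from $\Gamma,A\vdash B$ infer $\Gamma\vdash A\Rightarrow B$; $\neg_L$: from $\Gamma\vdash A$ infer $\Gamma,\neg A\vdash\Delta$; $\neg_R$: from $\Gamma,A\vdash$ infer $\Gamma\vdash\neg A$; $\exists_L$: from $\Gamma,A[c/x]\vdash\Delta$ infer $\Gamma,\exists xA\vdash\Delta$; $\exists_R$: from $\Gamma\vdash A[t/x]$ infer $\Gamma\vdash\exists xA$; $\forall_L$: from $\Gamma,A[t/x]\vdash\Delta$ infer $\Gamma,\forall xA\vdash\Delta$; $\forall_R$: from $\Gamma\vdash A[c/x]$ infer $\Gamma\vdash\forall xA$; left contraction; left weakening; right weakening (from $\Gamma\vdash$ infer $\Gamma\vdash A$); no cut. In $\forall_R,\exists_L$, $c$ is a fresh constant; in $\forall_L,\exists_R$, $t$ is any term. A focused sequent is $\Gamma\vdash S;\Delta$ where $\Gamma,\Delta$ are finite multisets and the stoup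 $S$ is either one formula $A$ (written $\Gamma\vdash A;\Delta$) or empty (written $\Gamma\vdash .;\Delta$). The focused classical sequent calculus has the rules: ax: $\Gamma,A\vdash .;A,\Delta$ with $A$ atomic; $\wedge_L$: from $\Gamma,A,B\vdash .;\Delta$ infer $\Gamma,A\wedge B\vdash .;\Delta$; $\wedge_R$: from $\Gamma\vdash A;\Delta$ and $\Gamma\vdash B;\Delta$ infer $\Gamma\vdash A\wedge B;\Delta$; $\vee_L$: from $\Gamma,A\vdash .;\Delta$ and $\Gamma,B\vdash .;\Delta$ infer $\Gamma,A\vee B\vdash .;\Delta$; $\vee_R$: from $\Gamma\vdash .;A,B,\Delta$ infer $\Gamma\vdash .;A\vee B,\Delta$; $\Rightarrow_L$: from $\Gamma\vdash A;\Delta$ and $\Gamma,B\vdash .;\Delta$ infer $\Gamma,A\Rightarrow B\vdash .;\Delta$; $\Rightarrow_R$: from $\Gamma,A\vdash B;\Delta$ infer $\Gamma\vdash A\Rightarrow B;\Delta$; $\neg_L$: from $\Gamma\vdash A;\Delta$ infer $\Gamma,\neg A\vdash .;\Delta$; $\neg_R$: from $\Gamma,A\vdash .;\Delta$ infer $\Gamma\vdash .;\neg A,\Delta$; $\exists_L$: from $\Gamma,A[c/x]\vdash .;\Delta$ infer $\Gamma,\exists xA\vdash .;\Delta$; $\exists_R$: from $\Gamma\vdash .;A[t/x],\Delta$ infer $\Gamma\vdash .;\exists xA,\Delta$; $\forall_L$: from $\Gamma,A[t/x]\vdash .;\Delta$ infer $\Gamma,\forall xA\vdash .;\Delta$; $\forall_R$: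 from $\Gamma\vdash A[c/x];\Delta$ infer $\Gamma\vdash\forall xA;\Delta$; contr$_L$: from $\Gamma,A,A\vdash .;\Delta$ infer $\Gamma,A\vdash .;\Delta$; contr$_R$: from $\Gamma\vdash .;A,A,\Delta$ infer $\Gamma\vdash .;A,\Delta$; weak$_L$: from $\Gamma\vdash .;\Delta$ infer $\Gamma,A\vdash .;\Delta$; weak$_R$: from $\Gamma\vdash .;\Delta$ infer $\Gamma\vdash A;\Delta$; focus: from $\Gamma\vdash A;\Delta$ infer $\Gamma\vdash .;A,\Delta$, provided $A$ is neither atomic nor of the form $\exists xB$, $B\vee C$, $\neg B$; release: from $\Gamma\vdash .;A,\Delta$ infer $\Gamma\vdash A;\Delta$, provided $A$ is atomic or of the form $\exists xB$, $B\vee C$ or $\neg B$. In $\forall_R$ and $\exists_L$, $c$ is a fresh constant; in $\forall_L$ and $\exists_R$, $t$ is any term. *)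

(* Defs.v *)
From Stdlib Require Export List Permutation.
From Stdlib Require Vector.
Export ListNotations.
Set Implicit Arguments.
Unset Strict Implicit.

(* Constants are kept apart from function symbols because they serve as the
   eigen-symbols of the quantifier rules.  A language with an unlimited supply
   of fresh constants is one whose type [const] is infinite. *)
Record signature := {
  const : Type;
  func : Type;
  func_ar : func -> nat;
  predicate : Type;
  pred_ar : predicate -> nat
}.

(* Bound variables are de Bruijn indices, so that syntactic equality is
   equality up to renaming of bound variables and substitution is
   capture-avoiding.  An index not bound by a quantifier is a free variable. *)
Inductive term (Sg : signature) : Type :=
| Var (n : nat)
| Const (c : const Sg)
| App (f : func Sg) (ts : Vector.t (term Sg) (func_ar f)).

Inductive formula (Sg : signature) : Type :=
| Atom (P : predicate Sg) (ts : Vector.t (term Sg) (pred_ar P))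
| And (A B : formula Sg)
| Or (A B : formula Sg)
| Imp (A B : formula Sg)
| Neg (A : formula Sg)
| All (A : formula Sg)
| Ex (A : formula Sg).

Arguments Var {Sg} n.
Arguments App {Sg} f ts.
Arguments Atom {Sg} P ts.

Fixpoint subst_term (Sg : signature) (s : nat -> term Sg) (t : term Sg) : term Sg :=
  match t with
  | Var n => s n
  | Const c => Const c
  | App f ts => App f (Vector.map (subst_term s) ts)
  end.

Definition scons (Sg : signature) (t : term Sg) (s : nat -> term Sg) (n : nat) : term Sg :=
  match n with
  | 0 => t
  | S m => s m
  end.

Definition up (Sg : signature) (s : nat -> term Sg) : nat -> term Sg :=
  scons (Var 0) (fun n => subst_term (fun m => Var (S m)) (s n)).

Fixpoint subst (Sg : signature) (s : nat -> term Sg) (A : formula Sg) : formula Sg :=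
  match A with
  | Atom P ts => Atom P (Vector.map (subst_term s) ts)
  | And A B => And (subst s A) (subst s B)
  | Or A B => Or (subst s A) (subst s B)
  | Imp A B => Imp (subst s A) (subst s B)
  | Neg A => Neg (subst s A)
  | All A => All (subst (up s) A)
  | Ex A => Ex (subst (up s) A)
  end.

(* If [A] is the body of a quantifier over x, then [inst A t] is A[t/x]. *)
Definition inst (Sg : signature) (A : formula Sg) (t : term Sg) : formula Sg :=
  subst (scons t Var) A.

Inductive occurs_term (Sg : signature) (c : const Sg) : term Sg -> Prop :=
| occurs_Const : occurs_term c (Const c)
| occurs_App (f : func Sg) (ts : Vector.t (term Sg) (func_ar f)) (t : term Sg) :
    Vector.In t ts -> occurs_term c t -> occurs_term c (App f ts).

Fixpoint occurs (Sg : signature) (c : const Sg) (A : formula Sg) : Prop :=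
  match A with
  | Atom P ts => exists t, Vector.In t ts /\ occurs_term c t
  | And A B | Or A B | Imp A B => occurs c A \/ occurs c B
  | Neg A | All A | Ex A => occurs c A
  end.

Definition fresh (Sg : signature) (c : const Sg) (Gamma : list (formula Sg)) : Prop :=
  forall A, In A Gamma -> ~ occurs c A.

Definition fresh_opt (Sg : signature) (c : const Sg) (S : option (formula Sg)) : Prop :=
  forall A, S = Some A -> ~ occurs c A.

Definition atomic (Sg : signature) (A : formula Sg) : Prop :=
  match A with
  | Atom _ _ => True
  | _ => False
  end.

Definition antineg (Sg : signature) (A : formula Sg) : formula Sg :=
  match A with
  | Neg B => B
  | _ => Neg A
  end.

Fixpoint ptr (Sg : signature) (A : formula Sg) : formula Sg :=
  match A with
  | Atom P ts => Atom P ts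
  | And A B => And (ptr A) (ptr B)
  | Or A B => Or (ptr A) (ptr B)
  | Imp A B => Imp (ntr A) (ptr B)
  | Neg A => Neg (ntr A)
  | All A => All (ptr A)
  | Ex A => Ex (ptr A)
  end
with ntr (Sg : signature) (A : formula Sg) : formula Sg :=
  match A with
  | Atom P ts => Neg (Neg (Atom P ts))
  | And A B => And (ntr A) (ntr B)
  | Or A B => Neg (And (Neg (ntr A)) (Neg (ntr B)))
  | Imp A B => Imp (ptr A) (ntr B)
  | Neg A => Neg (ptr A)
  | All A => All (ntr A)
  | Ex A => Neg (All (Neg (ntr A)))
  end.

(* In both calculi below, finite multisets are lists considered up to
   [Permutation]: the constructor [*_perm] is not a logical rule, it only makes
   derivability a property of the underlying multisets. *)

(* [intui Gamma Delta]: the sequent Gamma |- Delta is provable in the cut-free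
   intuitionistic calculus; Delta = None is the empty right-hand side. *)
Inductive intui (Sg : signature) :
  list (formula Sg) -> option (formula Sg) -> Prop :=
| i_perm Gamma Gamma' Delta :
    Permutation Gamma Gamma' -> intui Gamma Delta -> intui Gamma' Delta
| i_ax Gamma A :
    intui (A :: Gamma) (Some A)
| i_andL Gamma A B Delta :
    intui (A :: B :: Gamma) Delta -> intui (And A B :: Gamma) Delta
| i_andR Gamma A B :
    intui Gamma (Some A) -> intui Gamma (Some B) -> intui Gamma (Some (And A B))
| i_orL Gamma A B Delta :
    intui (A :: Gamma) Delta -> intui (B :: Gamma) Delta ->
    intui (Or A B :: Gamma) Delta
| i_orR1 Gamma A B :
    intui Gamma (Some A) -> intui Gamma (Some (Or A B))
| i_orR2 Gamma A B :
    intui Gamma (Some B) -> intui Gamma (Some (Or A B))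
| i_impL Gamma A B Delta :
    intui Gamma (Some A) -> intui (B :: Gamma) Delta ->
    intui (Imp A B :: Gamma) Delta
| i_impR Gamma A B :
    intui (A :: Gamma) (Some B) -> intui Gamma (Some (Imp A B))
| i_negL Gamma A Delta :
    intui Gamma (Some A) -> intui (Neg A :: Gamma) Delta
| i_negR Gamma A :
    intui (A :: Gamma) None -> intui Gamma (Some (Neg A))
| i_exL Gamma A c Delta :
    fresh c (Ex A :: Gamma) -> fresh_opt c Delta ->
    intui (inst A (Const c) :: Gamma) Delta -> intui (Ex A :: Gamma) Delta
| i_exR Gamma A t :
    intui Gamma (Some (inst A t)) -> intui Gamma (Some (Ex A))
| i_allL Gamma A t Delta :
    intui (inst A t :: Gamma) Delta -> intui (All A :: Gamma) Delta
| i_allR Gamma A c :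
    fresh c (All A :: Gamma) ->
    intui Gamma (Some (inst A (Const c))) -> intui Gamma (Some (All A))
| i_contrL Gamma A Delta :
    intui (A :: A :: Gamma) Delta -> intui (A :: Gamma) Delta
| i_weakL Gamma A Delta :
    intui Gamma Delta -> intui (A :: Gamma) Delta
| i_weakR Gamma A :
    intui Gamma None -> intui Gamma (Some A).

(* The formulas that may leave the stoup by release and may not enter it by
   focus. *)
Definition releasable (Sg : signature) (A : formula Sg) : Prop :=
  match A with
  | Atom _ _ | Ex _ | Or _ _ | Neg _ => True
  | And _ _ | Imp _ _ | All _ => False
  end.

(* [focused Gamma S Delta]: the sequent Gamma |- S ; Delta is provable in the
   focused classical calculus; S = None is the empty stoup. *)
Inductive focused (Sg : signature) :
  list (formula Sg) -> option (formula Sg) -> list (formula Sg) -> Prop :=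
| f_perm Gamma Gamma' S Delta Delta' :
    Permutation Gamma Gamma' -> Permutation Delta Delta' ->
    focused Gamma S Delta -> focused Gamma' S Delta'
| f_ax Gamma A Delta :
    atomic A -> focused (A :: Gamma) None (A :: Delta)
| f_andL Gamma A B Delta :
    focused (A :: B :: Gamma) None Delta -> focused (And A B :: Gamma) None Delta
| f_andR Gamma A B Delta :
    focused Gamma (Some A) Delta -> focused Gamma (Some B) Delta ->
    focused Gamma (Some (And A B)) Delta
| f_orL Gamma A B Delta :
    focused (A :: Gamma) None Delta -> focused (B :: Gamma) None Delta ->
    focused (Or A B :: Gamma) None Delta
| f_orR Gamma A B Delta :
    focused Gamma None (A :: B :: Delta) -> focused Gamma None (Or A B :: Delta)
| f_impL Gamma A B Delta :
    focused Gamma (Some A) Delta -> focused (B :: Gamma) None Delta ->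
    focused (Imp A B :: Gamma) None Delta
| f_impR Gamma A B Delta :
    focused (A :: Gamma) (Some B) Delta -> focused Gamma (Some (Imp A B)) Delta
| f_negL Gamma A Delta :
    focused Gamma (Some A) Delta -> focused (Neg A :: Gamma) None Delta
| f_negR Gamma A Delta :
    focused (A :: Gamma) None Delta -> focused Gamma None (Neg A :: Delta)
| f_exL Gamma A c Delta :
    fresh c (Ex A :: Gamma) -> fresh c Delta ->
    focused (inst A (Const c) :: Gamma) None Delta ->
    focused (Ex A :: Gamma) None Delta
| f_exR Gamma A t Delta :
    focused Gamma None (inst A t :: Delta) -> focused Gamma None (Ex A :: Delta)
| f_allL Gamma A t Delta :
    focused (inst A t :: Gamma) None Delta -> focused (All A :: Gamma) None Delta
| f_allR Gamma A c Delta :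
    fresh c (All A :: Gamma) -> fresh c Delta ->
    focused Gamma (Some (inst A (Const c))) Delta ->
    focused Gamma (Some (All A)) Delta
| f_contrL Gamma A Delta :
    focused (A :: A :: Gamma) None Delta -> focused (A :: Gamma) None Delta
| f_contrR Gamma A Delta :
    focused Gamma None (A :: A :: Delta) -> focused Gamma None (A :: Delta)
| f_weakL Gamma A Delta :
    focused Gamma None Delta -> focused (A :: Gamma) None Delta
| f_weakR Gamma A Delta :
    focused Gamma None Delta -> focused Gamma (Some A) Delta
| f_focus Gamma A Delta :
    ~ releasable A ->
    focused Gamma (Some A) Delta -> focused Gamma None (A :: Delta)
| f_release Gamma A Delta :
    releasable A ->
    focused Gamma None (A :: Delta) -> focused Gamma (Some A) Delta.

(* Main.v *)
Require Import Defs.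

(** Induction on the focused derivation.  The side conditions of focus and
    release match the shape of A^n: for releasable A it is a negation, so
    antinegation strips it and release becomes right negation; otherwise it is
    not, so antinegation adds a negation and focus becomes left negation.
    Where the translation of a disjunction or existential asks for ¬A^n instead
    of ⌟A^n on the left, the former is weaker only by a double negation, which
    is harmless because the right-hand side is then empty. *)

(** Both halves are proved together because the translations call each other at [Imp] and [Neg]; [s]
    is general because it becomes [up s] under a quantifier. *)
Lemma ptr_ntr_subst (Sg : signature) (A : formula Sg) :
  forall s, ptr (subst s A) = subst s (ptr A) /\ ntr (subst s A) = subst s (ntr A).
Proof.
  induction A as [P ts|A IHA B IHB|A IHA B IHB|A IHA B IHB|A IHA|A IHA|A IHA];
    intro s; cbn; try (destruct (IHA s) as [-> ->]);
    try (destruct (IHB s) as [-> ->]); try (destruct (IHA (up s)) as [-> ->]);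
    split; reflexivity.
Qed.

Lemma ptr_inst (Sg : signature) (A : formula Sg) t :
  ptr (inst A t) = inst (ptr A) t.
Proof. apply ptr_ntr_subst. Qed.

Lemma ntr_inst (Sg : signature) (A : formula Sg) t :
  ntr (inst A t) = inst (ntr A) t.
Proof. apply ptr_ntr_subst. Qed.

Lemma occurs_ptr_ntr (Sg : signature) (c : const Sg) (A : formula Sg) :
  (occurs c (ptr A) <-> occurs c A) /\ (occurs c (ntr A) <-> occurs c A).
Proof. induction A; cbn in *; tauto. Qed.

Lemma occurs_antineg (Sg : signature) (c : const Sg) (A : formula Sg) :
  occurs c (antineg A) <-> occurs c A.
Proof. destruct A; cbn; tauto. Qed.

Lemma fresh_cons (Sg : signature) (c : const Sg) A Gamma :
  fresh c (A :: Gamma) <-> ~ occurs c A /\ fresh c Gamma.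
Proof.
  unfold fresh; cbn; split.
  - intro H; split; auto.
  - intros [HA HG] B [<- | HB]; auto.
Qed.

(** Lets the eigenconstant of a focused quantifier rule be reused: translation and antinegation keep
    exactly the same constants. *)
Lemma fresh_translation (Sg : signature) (c : const Sg) Gamma Delta :
  fresh c Gamma -> fresh c Delta ->
  fresh c (map (@ptr Sg) Gamma ++ map (fun B => antineg (ntr B)) Delta).
Proof.
  intros HG HD B [HB | HB]%in_app_or;
    apply in_map_iff in HB as (C & <- & HC); rewrite ?occurs_antineg.
  - rewrite (proj1 (occurs_ptr_ntr Sg c C)); auto.
  - rewrite (proj2 (occurs_ptr_ntr Sg c C)); auto.
Qed.

Lemma antineg_ntr_releasable (Sg : signature) (A : formula Sg) :
  releasable A -> ntr A = Neg (antineg (ntr A)).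
Proof. destruct A; cbn; tauto. Qed.

Lemma antineg_ntr_not_releasable (Sg : signature) (A : formula Sg) :
  ~ releasable A -> antineg (ntr A) = Neg (ntr A).
Proof. destruct A; cbn; tauto. Qed.

(** Brings the image of the head of [Delta], which lies behind the image of [Gamma], to the front,
    where the left rules act. *)
Lemma intui_middle (Sg : signature) Gamma Gamma' (A : formula Sg) S :
  intui (A :: Gamma ++ Gamma') S <-> intui (Gamma ++ A :: Gamma') S.
Proof.
  split; apply i_perm; [|symmetry]; apply Permutation_middle.
Qed.

(** Only [A = Neg B] needs work: right then left negation turn [B] into [Neg (Neg B)]. *)
Lemma intui_negL_of_antinegL (Sg : signature) Gamma (A : formula Sg) :
  intui (antineg A :: Gamma) None -> intui (Neg A :: Gamma) None.
Proof.
  destruct A; cbn; auto using i_negL, i_negR.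
Qed.

Theorem theorem3 (Sg : signature) (Gamma Delta : list (formula Sg))
    (A : option (formula Sg)) :
  focused Gamma A Delta ->
  intui (map (@ptr Sg) Gamma ++ map (fun B => antineg (ntr B)) Delta)
        (option_map (@ntr Sg) A).
Proof.
  induction 1 as
    [Gamma Gamma' S Delta Delta' HG HD _ IH
    |Gamma A Delta HA
    |Gamma A B Delta _ IH
    |Gamma A B Delta _ IHA _ IHB
    |Gamma A B Delta _ IHA _ IHB
    |Gamma A B Delta _ IH
    |Gamma A B Delta _ IHA _ IHB
    |Gamma A B Delta _ IH
    |Gamma A Delta _ IH
    |Gamma A Delta _ IH
    |Gamma A c Delta HcG HcD _ IH
    |Gamma A t Delta _ IH
    |Gamma A t Delta _ IH
    |Gamma A c Delta HcG HcD _ IH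
    |Gamma A Delta _ IH
    |Gamma A Delta _ IH
    |Gamma A Delta _ IH
    |Gamma A Delta _ IH
    |Gamma A Delta HA _ IH
    |Gamma A Delta HA _ IH];
    cbn in *; rewrite <- ?intui_middle in *.
  - eapply i_perm, IH.
    apply Permutation_app; apply Permutation_map; assumption.
  - destruct A; try contradiction; cbn.
    (* For an atom [A], antinegation of [Neg (Neg A)] leaves [Neg A], contradicting the [A] on the
       left. *)
    apply (intui_middle _ (_ :: _)), i_negL, i_ax.
  - apply i_andL, IH.
  - apply i_andR; assumption.
  - apply i_orL; assumption.
  (* Antinegation exposes the conjunction of [Neg (ntr A)] and [Neg (ntr B)]; each conjunct is
     weakened to its antinegation in turn. *)
  - apply i_andL, intui_negL_of_antinegL.
    eapply i_perm; [apply perm_swap|].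
    apply intui_negL_of_antinegL.
    eapply i_perm; [apply perm_swap|].
    eapply i_perm, IH.
    apply perm_skip; symmetry; apply Permutation_middle.
  - apply i_impL; assumption.
  - apply i_impR, IH.
  - apply i_negL, IH.
  (* Antinegation reduces [Neg (ptr A)] to [ptr A], so premise and conclusion have the same
     image. *)
  - exact IH.
  - apply fresh_cons in HcG as [HcA HcG]; cbn in HcA.
    apply i_exL with c.
    + apply fresh_cons; split; [|apply fresh_translation; assumption].
      cbn; rewrite (proj1 (occurs_ptr_ntr Sg c A)); exact HcA.
    + discriminate.
    + rewrite <- ptr_inst; exact IH.
  - apply i_allL with t.
    change (inst (Neg (ntr A)) t) with (Neg (inst (ntr A) t)).
    rewrite <- ntr_inst; apply intui_negL_of_antinegL, IH.
  - apply i_allL with t; rewrite <- ptr_inst; exact IH.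
  - apply fresh_cons in HcG as [HcA HcG]; cbn in HcA.
    apply i_allR with c.
    + apply fresh_cons; split; [|apply fresh_translation; assumption].
      cbn; rewrite (proj2 (occurs_ptr_ntr Sg c A)); exact HcA.
    + rewrite <- ntr_inst; exact IH.
  - apply i_contrL, IH.
  - apply i_contrL; eapply i_perm, IH.
    apply perm_skip; symmetry; apply Permutation_middle.
  - apply i_weakL, IH.
  - apply i_weakR, IH.
  - rewrite (antineg_ntr_not_releasable Sg A HA); apply i_negL, IH.
  - rewrite (antineg_ntr_releasable Sg A HA); apply i_negR, IH.
Qed.
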